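(* Let $f:(0,1)\to(0,\infty)$ be increasing with $\lim_{t \downarrow 0}f(t)=0$ and $\phi:(0,\infty) \to (0,\infty)$ be decreasing with $\lim_{u \to \infty} \phi(u)=0$. Let the positive sequence $(\theta_n)_{n\in\mathbb{N}}$ satisfy $\lim_{n\to \infty}\theta_n=\infty$ and define the associated sequence $(t_n)_{n\in\mathbb{N}}$ given by $t_n:= \phi(\theta_n)$ for any $n \in \mathbb{N}$, where it is assumed that $t_n\in(0,1)$ for all $n$. (a) If $\sum_{n=1}^\infty \exp(\theta_n t_n-\Psi_{f(t_n)}(\theta_n))<\infty$, then $\limsup_{t \downarrow 0}L_t/f(t)\leq \limsup_{n \to \infty}f(t_n)/f(t_{n+1})$ a.s. (b) If $\lim_{u\to\infty}\phi(u)u=\infty$, $\sum_{n=1}^\infty [\exp(-\Psi_{f(t_n)}(\theta_n))-\exp(-\theta_n t_n)]=\infty$ and $\sum_{n=1}^\infty \Psi_{f(t_{n+1})}( \theta_n)<\infty$, then $\limsup_{t \downarrow 0} L_t/f(t)\geq 1$ a.s.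
   Context: $Y=(Y_t)_{t\ge0}$ is a pure-jump right-continuous non-decreasing additive process (i.e. with independent, possibly non-stationary, increments) with $Y_0=0$ a.s. and mean jump measure $\Pi(dt,dx)$ on $[0,\infty)\times(0,\infty)$; that is, $Y_t$ is the sum of its jumps up to time $t$, the jumps form a Poisson random measure with mean measure $\Pi$, and for all $t,u\ge0$, $\mathbb{E}[e^{-uY_t}]=e^{-\Psi_t(u)}$ with $\Psi_t(u):=\int_{(0,\infty)}(1-e^{-ux})\,\Pi((0,t],dx)$. $L_t:=\inf\{u>0:Y_u>t\}$, $t\ge0$ (with $\inf\emptyset=\infty$), is the right-continuous inverse of $Y$. *)

(* Defs.v *)
From HB Require Import structures.
From mathcomp Require Import all_boot all_order all_algebra.
From mathcomp Require Import all_classical all_reals all_analysis.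
From mathcomp Require Import measurable_realfun.

Set Implicit Arguments.
Unset Strict Implicit.
Unset Printing Implicit Defensive.

Import Order.TTheory GRing.Theory Num.Theory.
Import numFieldNormedType.Exports.

Local Open Scope classical_set_scope.
Local Open Scope ring_scope.

(* Mutual independence of the finite family X_0, ..., X_(n-1).  Subfamilies
   need no separate clause: take A i = setT for the indices left out. *)
Definition mutually_independent d (T : measurableType d) (R : realType)
    (P : probability T R) d' (S : measurableType d') (n : nat)
    (X : 'I_n -> T -> S) : Prop :=
  forall A : 'I_n -> set S, (forall i, measurable (A i)) ->
    P (\bigcap_(i in [set: 'I_n]) (X i @^-1` A i)) =
    (\prod_(i < n) P (X i @^-1` A i))%E.

(* The Poisson weights are written out because the library's poisson_pmf is
   identically 1 at rate 0; here rate 0 gives the point mass at 0. *)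
Record poisson_random_measure d (T : measurableType d) (R : realType)
    (P : probability T R) d' (S : measurableType d')
    (N : T -> {measure set S -> \bar R}) (nu : {measure set S -> \bar R}) :
    Prop := PoissonRandomMeasure {
  prm_measurable : forall B : set S, measurable B ->
    measurable_fun [set: T] (fun w => N w B);
  prm_poisson : forall (B : set S) (k : nat), measurable B -> (nu B < +oo)%E ->
    P [set w | N w B = k%:R%:E] =
    (fine (nu B) ^+ k / k`!%:R * expR (- fine (nu B)))%:E;
  prm_infinite : forall B : set S, measurable B -> nu B = +oo%E ->
    {ae P, forall w, N w B = +oo%E};
  prm_independent : forall (n : nat) (B : 'I_n -> set S),
    (forall i, measurable (B i)) -> trivIset [set: 'I_n] B ->
    mutually_independent P (fun i w => N w (B i))
}.

(* A process is a map Y : R -> T -> R of which only the times t >= 0 matter. *)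
Section jumps.
Context d (T : measurableType d) (R : realType).
Implicit Types (Y : R -> T -> R) (w : T).

Definition jump Y (s : R) w : R := Y s w - lim (Y u w @[u --> s^'-]).

Definition jump_points Y w : set (R * R) :=
  [set z | [/\ 0 < z.1, 0 < z.2 & z.2 = jump Y z.1 w]].

Definition jump_measure Y w : set (R * R) -> \bar R :=
  fun B => counting (B `&` jump_points Y w).

Section jump_measure_measure.
Variables (Y : R -> T -> R) (w : T).

Let discrete := g_sigma_algebraType [set: set (R * R)].

Let mdiscrete (A : set discrete) : measurable A.
Proof. exact: sub_sigma_algebra. Qed.

Let jump_measure0 : jump_measure Y w set0 = 0%E.
Proof. by rewrite /jump_measure set0I (@measure0 _ discrete R counting). Qed.

Let jump_measure_ge0 B : (0 <= jump_measure Y w B)%E.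
Proof. exact: (@measure_ge0 _ discrete R counting). Qed.

Let jump_measure_sigma_additive : semi_sigma_additive (jump_measure Y w).
Proof.
move=> F mF tF mUF; rewrite /jump_measure setI_bigcupl.
have := @measure_semi_sigma_additive _ discrete R counting
  (fun n => F n `&` jump_points Y w).
apply=> //.
exact: trivIset_setIr.
Qed.

HB.instance Definition _ := isMeasure.Build _ (R * R)%type R
  (jump_measure Y w) jump_measure0 jump_measure_ge0 jump_measure_sigma_additive.

End jump_measure_measure.

(* inf of the empty set is +oo. *)
Definition process_inverse Y (t : R) w : \bar R :=
  ereal_inf [set u%:E | u in [set u : R | 0 < u /\ t < Y u w]].

End jumps.

Section laplace_exponent.
Context (R : realType).
Variable Pi : {measure set (R * R) -> \bar R}.

(* The measure Pi((0, t], dx). *)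
Definition time_slice (t : R) : set R -> \bar R :=
  fun A => Pi (`]0, t] `*` A).

Section time_slice_measure.
Variable t : R.

Let time_slice0 : time_slice t set0 = 0%E.
Proof. by rewrite /time_slice setX0 measure0. Qed.

Let time_slice_ge0 A : (0 <= time_slice t A)%E.
Proof. exact: measure_ge0. Qed.

Let time_slice_sigma_additive : semi_sigma_additive (time_slice t).
Proof.
move=> F mF tF mUF; rewrite /time_slice setX_bigcupr.
apply: measure_semi_sigma_additive.
- by move=> n; exact: measurableX.
- apply/trivIsetP => i j _ _ ij; rewrite -setXI.
  by move/trivIsetP : tF => /(_ _ _ I I ij) ->; rewrite setX0.
- by rewrite -setX_bigcupr; exact: measurableX.
Qed.

HB.instance Definition _ := isMeasure.Build _ R R
  (time_slice t) time_slice0 time_slice_ge0 time_slice_sigma_additive.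

End time_slice_measure.

Definition Psi (t u : R) : \bar R :=
  (\int[time_slice t]_(x in `]0%R, +oo[) (1 - expR (- (u * x)))%:E)%E.

End laplace_exponent.

(* Mathematically, pja_independent_increments and pja_laplace follow from the
   other clauses (the latter by Campbell's formula); they are kept because they
   belong to the description of the process.  As Y is real-valued, pja_laplace
   forces Psi Pi t u to be finite. *)
Record pure_jump_additive d (T : measurableType d) (R : realType)
    (P : probability T R) (Y : R -> T -> R)
    (Pi : {measure set (R * R) -> \bar R}) : Prop := PureJumpAdditive {
  pja_measurable : forall t : R, 0 <= t -> measurable_fun [set: T] (Y t);
  pja_start : {ae P, forall w, Y 0 w = 0};
  pja_nondecreasing : forall w (s t : R), 0 <= s -> s <= t ->
    Y s w <= Y t w;
  pja_right_continuous : forall w (t : R), 0 <= t ->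
    Y u w @[u --> t^'+] --> Y t w;
  pja_independent_increments : forall (n : nat) (s : nat -> R),
    0 <= s 0%N -> (forall i, s i <= s i.+1) ->
    mutually_independent P
      (fun (i : 'I_n) w => Y (s i.+1) w - Y (s i) w);
  pja_sum_of_jumps : {ae P, forall w, forall t : R, 0 <= t ->
    (Y t w)%:E = \esum_(s in `]0%R, t]) (jump Y s w)%:E};
  pja_carrier : Pi (~` (`[0, +oo[ `*` `]0, +oo[)) = 0%E;
  pja_jump_measure : poisson_random_measure P (jump_measure Y) Pi;
  pja_laplace : forall t u : R, 0 <= t -> 0 <= u ->
    'E_P[fun w => expR (- (u * Y t w))]%E = expeR (- Psi Pi t u)
}.

(* Main.v *)
Require Import Defs.
From HB Require Import structures.
From mathcomp Require Import all_boot all_order all_algebra.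
From mathcomp Require Import all_classical all_reals all_analysis.
From mathcomp Require Import measurable_realfun lra ring.

(** Write [a_n = f (t_n)]; as [Y] and [L] are inverse to each other, [L] is
    controlled at [t_n] by comparing [Y_(a_n)] with [t_n].

    (a) The series of the positive variables [exp (theta_n (t_n - Y_(a_n)))] has
    finite expectation, so its terms tend to 0 and [t_n < Y_(a_n)] eventually,
    i.e. [L_(t_n) <= a_n]; for small [s], comparing with the first [t_(n+1)] below
    [s] gives the bound.

    (b) It suffices that [Y_(a_n) <= t_n] infinitely often.  The variables
    [D_n = 1 - exp (- theta_n Y_(a_(n+1)))] have summable expectations, hence
    [\sum_n D_n < oo] a.s.  If [theta_(n+1) <= theta_n] infinitely often, then
    [Y_(a_n) <= Y_(a_(n+1))] for these [n] and [D_n -> 0] concludes.  Otherwise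
    [a_n] is eventually nonincreasing, the increments
    [X_n = Y_(a_n) - Y_(a_(n+1))] are independent, and the variables
    [Z_n = max (0, exp (- theta_n X_n) - exp (- theta_n t_n))] have a
    divergent sum of expectations, so [\sum_n Z_n = oo] a.s.  Since [Z_n <= D_n]
    whenever [t_n < Y_(a_n)], this inequality must fail infinitely often.
    Truncating the exponentials, instead of using the second Borel-Cantelli lemma
    for events [X_n <= c t_n], avoids any loss in the constant 1. *)

Set Implicit Arguments.
Unset Strict Implicit.
Unset Printing Implicit Defensive.

Import Order.TTheory GRing.Theory Num.Theory.
Import numFieldNormedType.Exports.

Local Open Scope classical_set_scope.
Local Open Scope ring_scope.

(** * Product formula for expectations of independent variables *)

Section independence.
Local Open Scope ereal_scope.

Import HBNNSimple.

(** The identity passes from indicators to simple functions by linearity, then to [h] by monotone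
    convergence. It serves to split one factor off an expected product, [G] being the product of the
    other factors and [c] the product of their integrals. *)
Lemma ge0_integral_mul_comp d (T : measurableType d) (R : realType)
    (mu : {measure set T -> \bar R}) d' (S : measurableType d') (X : T -> S)
    (G : T -> R) (c : \bar R) (h : S -> \bar R) :
  measurable_fun [set: T] X -> measurable_fun [set: T] G ->
  (forall w, 0 <= G w)%R -> c \is a fin_num -> 0 <= c ->
  measurable_fun [set: S] h -> (forall x, 0 <= h x) ->
  (forall A, measurable A ->
    \int[mu]_w ((G w)%:E * (\1_A (X w))%:E) = c * mu (X @^-1` A)) ->
  \int[mu]_w ((G w)%:E * h (X w)) = c * \int[mu]_w h (X w).
Proof.
move=> mX mG G0 cfin c0 mh h0 GX.
have mGE : measurable_fun [set: T] (EFin \o G) by exact/measurable_EFinP.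
have G0E w : 0 <= (G w)%:E by rewrite lee_fin.
pose g := nnsfun_approx measurableT mh.
have mgX n : measurable_fun [set: T] (fun w => (g n (X w))%:E).
  by apply/measurable_EFinP; exact: measurableT_comp.
have gh x : (g n x)%:E @[n --> \oo] --> h x.
  by apply: (cvg_nnsfun_approx (D := setT)).
have ndg x (m n : nat) : (m <= n)%N -> (g m x <= g n x)%R.
  by move=> mn; exact/lefP/nd_nnsfun_approx.
have simple n : \int[mu]_w ((G w)%:E * (g n (X w))%:E) =
    c * \int[mu]_w (g n (X w))%:E.
  have E w : (g n (X w))%:E =
      \sum_(r \in range (g n)) (r%:E * (\1_(g n @^-1` [set r]) (X w))%:E).
    by rewrite (fimfunE (g n)) -fsumEFin.
  have r0 r w : 0 <= r%:E * (\1_(g n @^-1` [set r]) (X w))%:E :> \bar R.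
    by rewrite -EFinM; exact: nnfun_muleindic_ge0.
  have mi r : measurable_fun [set: T]
      (fun w => (\1_(g n @^-1` [set r]) (X w))%:E : \bar R).
    by apply/measurable_EFinP; exact: measurableT_comp.
  under eq_integral do rewrite E ge0_mule_fsumr//.
  rewrite ge0_integral_fsum//; last 2 first.
  - by move=> r; apply: emeasurable_funM => //; exact: emeasurable_funM.
  - by move=> r w _; exact: mule_ge0.
  under [in RHS]eq_integral do rewrite E.
  rewrite ge0_integral_fsum//; last by move=> r; exact: emeasurable_funM.
  rewrite ge0_mule_fsumr; last by move=> r; exact: integral_ge0.
  apply: eq_fsbigr => r; rewrite inE => -[x _ <-].
  have gx0 : 0 <= (g n x)%:E by rewrite lee_fin.
  under eq_integral do rewrite muleCA.
  rewrite [in RHS]ge0_integralZl//.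
  rewrite ge0_integralZl//; last 2 first.
  - exact: emeasurable_funM.
  - by move=> w _; rewrite mule_ge0// lee_fin.
  rewrite GX//.
  rewrite muleCA; congr (_ * (_ * _)).
  rewrite [RHS](_ : _ =
    \int[mu]_w (\1_(X @^-1` (g n @^-1` [set g n x])) w)%:E)//.
  rewrite integral_indic ?setIT//.
  by rewrite -[X in measurable X]setTI; exact: mX.
have h1 : (\int[mu]_w (g n (X w))%:E) @[n --> \oo] --> \int[mu]_w h (X w).
  rewrite (_ : \int[mu]_w h (X w) =
      \int[mu]_w (limn (fun n => (g n (X w))%:E))).
    apply: cvg_monotone_convergence => //.
    - by move=> n w _; rewrite lee_fin.
    - by move=> w _ m n mn; rewrite lee_fin ndg.
  by apply: eq_integral => w _; apply/esym/cvg_lim.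
have h2 : (\int[mu]_w ((G w)%:E * (g n (X w))%:E)) @[n --> \oo] -->
    \int[mu]_w ((G w)%:E * h (X w)).
  rewrite (_ : \int[mu]_w ((G w)%:E * h (X w)) =
      \int[mu]_w (limn (fun n => (G w)%:E * (g n (X w))%:E))).
    apply: cvg_monotone_convergence => //.
    - by move=> n; exact: emeasurable_funM.
    - by move=> n w _; rewrite mule_ge0// lee_fin.
    - by move=> w _ m n mn; rewrite lee_wpmul2l// lee_fin ndg.
  apply: eq_integral => w _; apply/esym/cvg_lim => //.
  exact: cvgeZl.
rewrite -(cvg_lim _ h2)//; apply/cvg_lim => //.
by under eq_fun do rewrite simple; exact: cvgeZl.
Qed.

Lemma mutually_independent_integral_prod d (T : measurableType d) (R : realType)
    (P : probability T R) d' (S : measurableType d') (n : nat)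
    (X : 'I_n -> T -> S) (h : 'I_n -> S -> R) :
  (forall i, measurable_fun [set: T] (X i)) -> mutually_independent P X ->
  (forall i, measurable_fun [set: S] (h i)) ->
  (forall i x, 0 <= h i x <= 1)%R ->
  \int[P]_w (\prod_(i < n) h i (X i w))%:E =
  \prod_(i < n) \int[P]_w (h i (X i w))%:E.
Proof.
move=> mX indX.
(* Only the first [k] factors are arbitrary, the others being indicators: [k = 0] is the definition
   of independence and [k = n] is the claim. *)
suff H k : (forall i, measurable_fun [set: S] (h i)) ->
  (forall i x, 0 <= h i x <= 1)%R ->
  (forall i : 'I_n, (k <= i)%N -> exists2 A, measurable A & h i = \1_A) ->
  \int[P]_w (\prod_(i < n) h i (X i w))%:E =
  \prod_(i < n) \int[P]_w (h i (X i w))%:E.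
  by move=> mh h01; apply: (H n) => // i; rewrite leqNgt ltn_ord.
(* Indicators are replaced by arbitrary functions one index at a time. *)
elim: k => [|k IH] in h *.
  move=> _ _ /(_ _ isT)/cid2 - /all_sig2[A mA hA].
  have mXA i : measurable (X i @^-1` A i).
    by rewrite -[X in measurable X]setTI; exact: mX.
  under [RHS]eq_bigr => i _.
    rewrite hA (_ : (fun w => (\1_(A i) (X i w))%:E) =
      (fun w => (\1_(X i @^-1` A i) w)%:E))// integral_indic ?setIT//.
    over.
  rewrite -indX// -[X in P X]setIT -integral_indic//; last first.
    by apply: fin_bigcap_measurable.
  apply: eq_integral => w _; congr _%:E; rewrite indicE.
  case: (boolP (w \in _)) => [|].
    rewrite inE => wA; rewrite big1// => i _; rewrite hA indicE mem_set//.
    exact: wA.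
  rewrite notin_setE => /existsNP[i /not_implyP[_ nA]].
  by rewrite (bigD1 i)//= hA indicE memNset// mul0r.
move=> mh h01 hk; have [nk|kn] := leqP n k.
  by apply: IH => // i; rewrite leqNgt (leq_trans (ltn_ord i)).
have mhX i : measurable_fun [set: T] (fun w => h i (X i w)).
  exact: measurableT_comp.
have fin i : \int[P]_w (h i (X i w))%:E \is a fin_num.
  rewrite ge0_fin_numE; last first.
    by apply: integral_ge0 => w _; rewrite lee_fin; have /andP[] := h01 i (X i w).
  apply: (@le_lt_trans _ _ (\int[P]_w (cst 1 w))).
    apply: ge0_le_integral => //.
    - by move=> w _; rewrite lee_fin; have /andP[] := h01 i (X i w).
    - exact/measurable_EFinP.
    - by move=> w _; rewrite lee_fin; have /andP[] := h01 i (X i w).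
  by rewrite integral_cst//= mul1e (le_lt_trans (probability_le1 P _)) ?ltry.
pose i0 := Ordinal kn.
rewrite (bigD1 i0)//=.
under eq_integral do rewrite (bigD1 i0)//= mulrC EFinM.
rewrite muleC; apply: (ge0_integral_mul_comp (h := EFin \o h i0)) => //.
- under eq_fun do rewrite big_mkcond.
  by apply: measurable_prod => i _; case: (i != i0).
- by move=> w; apply: prodr_ge0 => i _; have /andP[] := h01 i (X i w).
- by apply: prode_fin_num.
- apply: prode_ge0 => i _; apply: integral_ge0 => w _; rewrite lee_fin.
  by have /andP[] := h01 i (X i w).
- exact/measurable_EFinP.
- by move=> x /=; rewrite lee_fin; have /andP[] := h01 i0 x.
move=> A mA.
(* With an indicator at index [k], the family [h'] falls under the induction hypothesis, which
   yields the identity on indicators required for [h i0]. *)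
pose h' i := if i == i0 then \1_A else h i.
have h'i i : i != i0 -> h' i = h i by rewrite /h' => /negbTE ->.
have h'0 : h' i0 = \1_A by rewrite /h' eqxx.
transitivity (\int[P]_w (\prod_(i < n) h' i (X i w))%:E).
  apply: eq_integral => w _; rewrite [in RHS](bigD1 i0)//= [in RHS]mulrC EFinM h'0.
  congr (_%:E * _).
  by apply: eq_bigr => i ii0; rewrite h'i.
rewrite IH.
- rewrite (bigD1 i0)//= h'0 muleC; congr (_ * _).
    by apply: eq_bigr => i ii0; rewrite h'i.
  rewrite (_ : (fun w => (\1_A (X i0 w))%:E) =
    (fun w => (\1_(X i0 @^-1` A) w)%:E))// integral_indic ?setIT//.
  by rewrite -[X in measurable X]setTI; exact: mX.
- by move=> i; rewrite /h'; case: ifP.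
- move=> i x; rewrite /h'; case: ifP => // _.
  by rewrite indicE; case: (_ \in _) => /=; rewrite ?lexx ler01.
- move=> i ki; rewrite /h'; case: eqP => [_|/eqP ii0]; first by exists A.
  apply: hk; rewrite ltn_neqAle ki andbT.
  by apply: contra_neq ii0 => kE; exact/val_inj.
Qed.

End independence.

(** * Almost sure convergence and divergence of series of nonnegative variables *)

Section series_of_random_variables.
Local Open Scope ereal_scope.
Context d (T : measurableType d) (R : realType).

(** By Tonelli the sum has a finite integral, hence is finite almost everywhere. *)
Lemma ae_nneseries_lty (mu : {measure set T -> \bar R})
    (g : nat -> T -> \bar R) :
  (forall n, measurable_fun [set: T] (g n)) -> (forall n w, 0 <= g n w) ->
  \sum_(n <oo) \int[mu]_w g n w < +oo ->
  {ae mu, forall w, \sum_(n <oo) g n w < +oo}.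
Proof.
move=> mg g0 gfin.
have s0 w : 0 <= \sum_(n <oo) g n w by apply: nneseries_ge0.
have : mu.-integrable [set: T] (fun w => \sum_(n <oo) g n w).
  apply/integrableP; split; first exact: ge0_emeasurable_sum.
  under eq_integral do rewrite gee0_abs//.
  by rewrite integral_nneseries.
move/(integrable_ae measurableT); apply: filterS => w /(_ I).
by rewrite ge0_fin_numE.
Qed.

Variable P : probability T R.

(** A second Borel-Cantelli lemma for variables in [[0, 1]]. Independence enters through the
    factorisation of the expectation of [exp (- \sum_(i < n) Z_i)]; this expectation tends to 0, so
    [exp (- \sum_n Z_n)] vanishes a.s. The lower bounds [p] may be negative, like the terms of the
    divergent series in (b). *)
Lemma ae_nneseries_pinfty (Z : nat -> T -> R) (p : nat -> R) :
  (forall n, measurable_fun [set: T] (Z n)) ->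
  (forall n w, 0 <= Z n w <= 1)%R ->
  (forall n, \int[P]_w (\prod_(i < n) expR (- Z i w))%:E =
    \prod_(i < n) \int[P]_w (expR (- Z i w))%:E) ->
  (forall n, (p n)%:E <= \int[P]_w (Z n w)%:E) ->
  (\sum_(0 <= i < n) p i)%R @[n --> \oo] --> +oo%R ->
  {ae P, forall w, \sum_(n <oo) (Z n w)%:E = +oo}.
Proof.
move=> mZ Z01 indZ pZ pdiv.
have Z0 n w : (0 <= Z n w)%R by have /andP[] := Z01 n w.
have Z0E n w : 0 <= (Z n w)%:E by rewrite lee_fin.
have mexp n : measurable_fun [set: T] (fun w => (expR (- Z n w))%:E).
  apply/measurable_EFinP; apply: (measurableT_comp (@measurable_expR R)).
  exact: measurableT_comp.
have exp0 n w : 0 <= (expR (- Z n w))%:E by rewrite lee_fin expR_ge0.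
(* On [[0, 1]], [exp (- z) <= 1 / (1 + z) <= 1 - z / 2]; this is the source of the factor 1/2.
   Taking expectations, [1 - p / 2 <= exp (- p / 2)] concludes. *)
have expZ n : \int[P]_w (expR (- Z n w))%:E <= (expR (- (p n / 2)))%:E.
  have mZ2 : measurable_fun [set: T] (fun w => 2^-1%:E * (Z n w)%:E).
    by apply: emeasurable_funM => //; exact/measurable_EFinP.
  have H : \int[P]_w (expR (- Z n w))%:E + 2^-1%:E * \int[P]_w (Z n w)%:E <= 1.
    rewrite -ge0_integralZl//; last exact/measurable_EFinP.
    rewrite -ge0_integralD//; last by move=> w _; rewrite mule_ge0// lee_fin.
    rewrite -(@probability_setT _ _ _ P) -[leRHS]mul1e -integral_cst//.
    apply: ge0_le_integral => //.
    - by move=> w _; rewrite adde_ge0// mule_ge0// lee_fin.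
    - exact: emeasurable_funD.
    - move=> w _ /=; rewrite -EFinM -EFinD lee_fin.
      have /andP[z0 z1] := Z01 n w.
      rewrite expRN.
      have := expR_ge1Dx (Z n w) => h.
      apply: (@le_trans _ _ ((1 + Z n w)^-1 + 2^-1 * Z n w)%R).
        by rewrite lerD2r lef_pV2 ?posrE ?expR_gt0//; lra.
      rewrite -lerBrDr -div1r ler_pdivrMr; last by lra.
      nra.
  have : \int[P]_w (expR (- Z n w))%:E + (2^-1 * p n)%:E <= 1.
    apply: le_trans H; rewrite leeD2l// EFinM lee_wpmul2l//.
  rewrite -leeBrDr// => /le_trans; apply; rewrite -EFinB lee_fin.
  by apply: le_trans (expR_ge1Dx _); lra.
(* [V = exp (- \sum_n Z_n)] has expectation at most [exp (- \sum_(i < n) p_i / 2)]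
   for every [n]. *)
pose U n w := (expR (- \sum_(0 <= i < n) Z i w))%:E.
have mU n : measurable_fun [set: T] (U n).
  apply/measurable_EFinP; apply: (measurableT_comp (@measurable_expR R)).
  by apply: measurableT_comp => //; exact: measurable_sum.
(* As an infimum over [n], [V] also makes sense where the series diverges, with value 0 there. *)
pose V w := einfs (U ^~ w) 0%N.
have V0 w : 0 <= V w.
  by apply: le_ereal_inf_tmp => _ [n _ <-]; rewrite lee_fin expR_ge0.
have mV : measurable_fun [set: T] V by exact: measurable_fun_einfs.
have VU n : \int[P]_w V w <= (expR (- ((\sum_(0 <= i < n) p i) / 2)))%:E.
  apply: (@le_trans _ _ (\int[P]_w U n w)).
    by apply: ge0_le_integral => // w _; apply: ereal_inf_lbound; exists n.
  under eq_integral do rewrite /U big_mkord -sumrN expR_sum.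
  rewrite indZ big_mkord mulr_suml -sumrN expR_sum -prodEFin.
  suff /andP[] : 0 <= \prod_(i < n) \int[P]_w (expR (- Z i w))%:E
      <= \prod_(i < n) (expR (- (p i / 2)))%:E by [].
  elim/big_ind2 : _ => [|x1 x2 y1 y2 /andP[x0 xx] /andP[y0 yy]|i _].
  - by rewrite lee01 lexx.
  - by rewrite mule_ge0//= lee_pmul.
  - by rewrite integral_ge0//=.
have iV : \int[P]_w V w = 0.
  apply/eqP; rewrite eq_le integral_ge0// andbT.
  apply/lee_addgt0Pr => e e0; rewrite add0e.
  (* Once the partial sum of [p] reaches [2 / e], the bound is at most [exp (- 1 / e)], which is
     below [e] because [exp (1 / e) >= 1 / e]. *)
  have [n _ /(_ n (leqnn n)) /= pn] := (cvgryPge _).1 pdiv (2 / e)%R.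
  apply: le_trans (VU n) _; rewrite lee_fin expRN -[leRHS]invrK.
  rewrite lef_pV2 ?posrE ?expR_gt0 ?invr_gt0//.
  apply: le_trans (expR_ge1Dx _); apply: ler_wpDl => //.
  by rewrite ler_pdivlMr// mulrC.
have : ae_eq P [set: T] V (cst 0).
  apply/ae_eq_integral_abs => //.
  by under eq_integral do rewrite gee0_abs//.
apply: filterS => w /(_ I) /= Vw0.
apply/eqP; rewrite eq_le leey/= leNgt; apply/negP => Sfin.
have S0 : 0 <= \sum_(n <oo) (Z n w)%:E by exact: nneseries_ge0.
suff : (expR (- fine (\sum_(n <oo) (Z n w)%:E)))%:E <= V w.
  by rewrite Vw0 lee_fin leNgt expR_gt0.
apply: le_ereal_inf_tmp => _ [n _ <-]; rewrite lee_fin ler_expR lerN2.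
rewrite -lee_fin fineK ?ge0_fin_numE// -sumEFin.
exact: nneseries_lim_ge.
Qed.

End series_of_random_variables.

(** * Pathwise bounds on the inverse, for a fixed outcome [w] *)

Section inverse_limsup.
Context d (T : measurableType d) (R : realType).
Variables (Y : R -> T -> R) (w : T) (f : R -> R) (t : nat -> R).
Hypothesis f_pos : forall x : R, 0 < x < 1 -> 0 < f x.
Hypothesis t_in01 : forall n, 0 < t n < 1.
Hypothesis t_lim : t n @[n --> \oo] --> 0.

(** If [t_(n+1) < s <= t_n < Y_(f (t_n))], then [L_s <= f (t_n)] while [f s >= f (t_(n+1))]. *)
Lemma limsup_inverse_le
    (f_incr : forall x y : R, 0 < x -> x <= y -> y < 1 -> f x <= f y)
    (tY : \forall n \near \oo, t n < Y (f (t n)) w) :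
  (limf_esup (fun s : R => process_inverse Y s w / (f s)%:E) 0%R^'+ <=
   limn_esup (fun n => (f (t n) / f (t n.+1))%:E))%E.
Proof.
apply: le_ereal_inf_tmp => _ [V [N1 _ VN1] <-].
case: tY => N2 _ YN2.
pose N := maxn N1 N2.
(* As [t] may oscillate, a positive lower bound of [t_0, ..., t_N] ensures that the indices [k] with
   [t_k < s] all exceed [N] when [s < delta]. *)
have [delta delta0 tdelta] : exists2 delta, 0 < delta &
    forall k, (k <= N)%N -> delta <= t k.
  elim: N => [|n [e e0 te]].
    exists (t 0%N); first by have /andP[] := t_in01 0.
    by move=> k; rewrite leqn0 => /eqP ->.
  exists (Num.min e (t n.+1)).
    by rewrite lt_min e0; have /andP[] := t_in01 n.+1.
  move=> k; rewrite leq_eqVlt => /orP[/eqP ->|kn].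
    by rewrite ge_min lexx orbT.
  by rewrite ge_min te.
apply: (@le_trans _ _ (ereal_sup
    [set (process_inverse Y s w / (f s)%:E)%E | s in `]0, delta[%classic])).
  apply: ereal_inf_lbound; exists `]0, delta[%classic => //.
  near=> s; rewrite /= in_itv/=; apply/andP; split; near: s.
    exact: nbhs_right_gt.
  exact: nbhs_right_lt.
apply: ge_ereal_sup => _ [s /= + <-]; rewrite in_itv/= => /andP[s0 sdelta].
have ex_ts : exists k, t k < s.
  have [k _ /(_ k (leqnn k))] := (cvgr_lt 0 t_lim) s s0.
  by exists k.
(* The first index with [t_k < s] is not 0, since [s < delta <= t_0]; written [n.+1], its minimality
   brackets [s] between [t_(n+1)] and [t_n]. *)
case: (ex_minnP ex_ts) => -[|n] tns nmin.
  by have := lt_trans sdelta (le_lt_trans (tdelta 0%N isT) tns); rewrite ltxx.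
have stn : s <= t n.
  by rewrite leNgt; apply/negP => /nmin; rewrite ltnn.
have Nn : (N <= n)%N.
  rewrite -ltnS ltnNge; apply/negP => /tdelta /le_lt_trans /(_ tns) /lt_trans.
  by move=> /(_ _ sdelta); rewrite ltxx.
have Vn : V n by apply: VN1; rewrite /= (leq_trans _ Nn)// leq_maxl.
have tYn : t n < Y (f (t n)) w.
  by apply: YN2; rewrite /= (leq_trans _ Nn)// leq_maxr.
have /andP[tn0 tn1] := t_in01 n; have /andP[tSn0 tSn1] := t_in01 n.+1.
have fs0 : 0 < f s by rewrite f_pos// s0 (le_lt_trans stn).
have ftn0 : 0 < f (t n) by rewrite f_pos// tn0.
have ftSn0 : 0 < f (t n.+1) by rewrite f_pos// tSn0.
apply: (@le_trans _ _ (f (t n) / f (t n.+1))%:E); last first.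
  by apply: ereal_sup_ubound; exists n.
apply: (@le_trans _ _ ((f (t n))%:E / (f s)%:E)%E).
  rewrite lee_wpmul2r// ?inve_ge0 ?lee_fin ?(ltW fs0)//.
  apply: ereal_inf_lbound; exists (f (t n)) => //=; split => //.
  exact: le_lt_trans tYn.
rewrite inver gt_eqF// -EFinM lee_fin ler_pM2l// lef_pV2 ?posrE//.
by apply: f_incr => //; [exact: ltW|exact: le_lt_trans tn1].
Unshelve. all: by end_near. Qed.

(** When [Y_(f (t_n)) <= t_n], monotonicity puts every [u] with [Y_u > t_n] at or above [f (t_n)],
    so the ratio at [s = t_n] is at least 1; such [t_n] come arbitrarily close to 0. *)
Lemma limsup_inverse_ge1
    (Y_mono : forall x y : R, 0 <= x -> x <= y -> Y x w <= Y y w)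
    (Yt : forall N, exists2 n, (N <= n)%N & Y (f (t n)) w <= t n) :
  (1 <= limf_esup (fun s : R => process_inverse Y s w / (f s)%:E) 0%R^'+)%E.
Proof.
apply: le_ereal_inf_tmp => _ [V V0 <-].
have [N _ tV] : \forall n \near \oo, V (t n).
  have [e /= e0 eV] := V0.
  have [N _ tN] := (cvgr_lt 0 t_lim) e e0.
  exists N => // n Nn; have /andP[tn0 _] := t_in01 n.
  by apply: eV => //=; rewrite sub0r normrN gtr0_norm//; exact: tN.
have [n Nn Ytn] := Yt N.
have fn0 : 0 < f (t n) by exact: f_pos.
apply: (@le_trans _ _ (process_inverse Y (t n) w / (f (t n))%:E)%E); last first.
  by apply: ereal_sup_ubound; exists (t n) => //; exact: tV.
apply: (@le_trans _ _ ((f (t n))%:E / (f (t n))%:E)%E).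
  by rewrite inver gt_eqF// -EFinM divff ?gt_eqF.
rewrite lee_wpmul2r ?inve_ge0 ?lee_fin ?(ltW fn0)//.
apply: le_ereal_inf_tmp => _ [u [u0 tu] <-]; rewrite lee_fin.
rewrite leNgt; apply/negP => uf.
have := le_lt_trans Ytn (lt_le_trans tu (Y_mono _ _ (ltW u0) (ltW uf))).
by rewrite ltxx.
Qed.

End inverse_limsup.

(** * Terms of convergent series and measurability of exponentials *)

Lemma nneseries_near_lt (R : realType) (u : (\bar R)^nat) (e : \bar R) :
  (forall n, 0 <= u n)%E -> (\sum_(n <oo) u n < +oo)%E -> (0 < e)%E ->
  \forall n \near \oo, (u n < e)%E.
Proof.
move=> u0 ufin e0.
have utail : (\sum_(n <= k <oo) u k)%E @[n --> \oo] --> 0%E.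
  exact: nneseries_tail_cvg.
have [N _ Ne] : \forall n \near \oo, (\sum_(n <= k <oo) u k < e)%E.
  exact: (utail _ (open_nbhs_nbhs (conj (@open_ereal_lt_ereal _ e) e0))).
exists N => // n /Ne; apply: le_lt_trans.
apply: le_trans (nneseries_lim_ge n.+1 (fun k _ _ => u0 k)).
by rewrite big_nat1.
Qed.

Lemma measurable_expR_affine d (T : measurableType d) (R : realType)
    (X : T -> R) (a b : R) :
  measurable_fun [set: T] X ->
  measurable_fun [set: T] (fun w => (expR (a - b * X w))%:E).
Proof.
move=> mX; apply/measurable_EFinP; apply: (measurableT_comp (@measurable_expR R)).
by apply: measurable_funB => //; exact: measurable_funM.
Qed.

Lemma measurable_expRM d (T : measurableType d) (R : realType)
    (X : T -> R) (b : R) :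
  measurable_fun [set: T] X ->
  measurable_fun [set: T] (fun w => (expR (- (b * X w)))%:E).
Proof.
move=> /(@measurable_expR_affine _ _ _ _ 0 b).
by under eq_fun do rewrite add0r.
Qed.

(** * Laplace transforms and almost sure comparison of [Y] with the levels [t_n] *)

Section additive_process.
Context d (T : measurableType d) (R : realType) (P : probability T R).
Variables (Y : R -> T -> R) (Pi : {measure set (R * R) -> \bar R}).
Hypothesis HY : pure_jump_additive P Y Pi.

Lemma Psi_ge0 (s u : R) : 0 <= u -> (0 <= Psi Pi s u)%E.
Proof.
move=> u0; apply: integral_ge0 => x /=; rewrite in_itv/= andbT => x0.
rewrite lee_fin subr_ge0 -[leRHS]expR0 ler_expR oppr_le0.
by rewrite mulr_ge0// ltW.
Qed.

Lemma laplace_transform (s u : R) : 0 <= s -> 0 <= u ->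
  (\int[P]_w (expR (- (u * Y s w)))%:E = expeR (- Psi Pi s u))%E.
Proof. by move=> s0 u0; rewrite -(pja_laplace HY)// unlock. Qed.

Lemma measurable_increment (s r : R) : 0 <= s -> 0 <= r ->
  measurable_fun [set: T] (fun w => Y s w - Y r w).
Proof.
by move=> s0 r0; apply: measurable_funB; exact: (pja_measurable HY).
Qed.

(** Subtracting [Y 0] gives a variable that is nonnegative at every outcome, since [Y 0] is known to
    vanish only almost surely. *)
Lemma laplace_transform_increment (s u : R) : 0 <= s -> 0 <= u ->
  (\int[P]_w (expR (- (u * (Y s w - Y 0 w))))%:E = expeR (- Psi Pi s u))%E.
Proof.
move=> s0 u0; rewrite -laplace_transform//; apply: ge0_ae_eq_integral => //.
- by apply: measurable_expRM; exact: measurable_increment.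
- by apply: measurable_expRM; exact: (pja_measurable HY).
- by apply: (filterS _ (pja_start HY)) => w Y0 _; rewrite Y0 subr0.
Qed.

Lemma laplace_transform_fin_num (s u : R) : 0 <= s -> 0 <= u ->
  expeR (- Psi Pi s u) \is a fin_num.
Proof.
move=> s0 u0; rewrite ge0_fin_numE ?expeR_ge0//.
apply: (@le_lt_trans _ _ 1%E); last exact: ltry.
by rewrite -expeR0 lee_expeR oppe_le0 Psi_ge0.
Qed.

(** The integral equals [1 - exp (- Psi)], and [1 - exp (- x) <= x]. *)
Lemma integral_1_sub_laplace (s u : R) : 0 <= s -> 0 <= u ->
  (\int[P]_w (1 - expR (- (u * (Y s w - Y 0 w))))%:E <= Psi Pi s u)%E.
Proof.
move=> s0 u0.
have D0 w : 0 <= 1 - expR (- (u * (Y s w - Y 0 w))).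
  rewrite subr_ge0 -[leRHS]expR0 ler_expR oppr_le0 mulr_ge0// subr_ge0.
  exact: (pja_nondecreasing HY).
have mE : measurable_fun [set: T] (fun w => (expR (- (u * (Y s w - Y 0 w))))%:E).
  by apply: measurable_expRM; exact: measurable_increment.
have mD : measurable_fun [set: T]
    (fun w => (1 - expR (- (u * (Y s w - Y 0 w))))%:E).
  apply/measurable_EFinP; apply: measurable_funB => //; exact/measurable_EFinP.
have : (\int[P]_w (1 - expR (- (u * (Y s w - Y 0 w))))%:E +
    expeR (- Psi Pi s u) = 1)%E.
  rewrite -laplace_transform_increment// -ge0_integralD//.
  - under eq_integral do rewrite -EFinD subrK.
    by rewrite integral_cst//= mul1e; exact: probability_setT.
  - by move=> w _; rewrite lee_fin.
move=> H; have fE := laplace_transform_fin_num s0 u0.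
rewrite -[leLHS](addeK _ fE) H leeBlDr//.
have := expeR_ge1Dx (- Psi Pi s u).
case: (Psi Pi s u) (Psi_ge0 s u0) fE => [x| |//] _ _ /=.
- by rewrite -!EFinD !lee_fin => h; lra.
- by rewrite addye// => _; exact: leey.
Qed.

(** Summability of the [D_n], used in both cases of (b) and recorded on the same almost sure event
    as [Y 0 = 0]. *)
Lemma ae_summable_laplace (a theta : nat -> R) :
  (forall n, 0 <= a n) -> (forall n, 0 <= theta n) ->
  (\sum_(n <oo) Psi Pi (a n) (theta n) < +oo)%E ->
  {ae P, forall w, Y 0 w = 0 /\
    (\sum_(n <oo) (1 - expR (- (theta n * (Y (a n) w - Y 0 w))))%:E < +oo)%E}.
Proof.
move=> a0 theta0 fin.
apply: filterS2 (pja_start HY) _; first by move=> w; exact: conj.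
apply: ae_nneseries_lty.
- move=> n; apply/measurable_EFinP; apply: measurable_funB => //.
  by apply/measurable_EFinP/measurable_expRM; exact: measurable_increment.
- move=> n w; rewrite lee_fin subr_ge0 -[leRHS]expR0 ler_expR oppr_le0.
  by rewrite mulr_ge0// subr_ge0; exact: (pja_nondecreasing HY).
apply: le_lt_trans fin; apply: lee_nneseries => [n _ _|n _].
  by apply: integral_ge0 => w _; rewrite lee_fin subr_ge0 -[leRHS]expR0 ler_expR
    oppr_le0 mulr_ge0// subr_ge0; exact: (pja_nondecreasing HY).
exact: integral_1_sub_laplace.
Qed.

(** The probabilistic half of (a): by the Laplace transform the given series is the sum of the
    expectations of [g n], and [g n w < 1] means that its exponent is negative. *)
Lemma ae_gt_near (a theta t : nat -> R) :
  (forall n, 0 <= a n) -> (forall n, 0 < theta n) ->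
  (\sum_(n <oo)
    expeR ((theta n * t n)%:E - Psi Pi (a n) (theta n)) < +oo)%E ->
  {ae P, forall w, \forall n \near \oo, t n < Y (a n) w}.
Proof.
move=> a0 theta0 fin.
pose g n w := (expR (theta n * t n - theta n * Y (a n) w))%:E.
have : {ae P, forall w, (\sum_(n <oo) g n w < +oo)%E}.
  apply: ae_nneseries_lty.
  - by move=> n; apply: measurable_expR_affine; exact: (pja_measurable HY).
  - by move=> n w; rewrite lee_fin expR_ge0.
  apply: le_lt_trans fin; apply: lee_nneseries => [n _ _|n _].
    by apply: integral_ge0 => w _; rewrite /g lee_fin expR_ge0.
  rewrite expeRD -(laplace_transform (a0 n) (ltW (theta0 n))) -ge0_integralZl//.
  - by under eq_integral do rewrite /g expRD EFinM.
  - by apply: measurable_expRM; exact: (pja_measurable HY).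
  - exact: expeR_ge0.
apply: filterS => w gfin.
have : \forall n \near \oo, (g n w < 1)%E.
  by apply: nneseries_near_lt => // n; rewrite lee_fin expR_ge0.
apply: filterS => n; rewrite lte_fin -[ltRHS]expR0 ltr_expR subr_lt0.
by rewrite ltr_pM2l.
Qed.

(** The probabilistic half of (b) for nonincreasing times [a], whose successive increments of [Y]
    are independent. *)
Lemma ae_le_infinitely_often (a theta t : nat -> R) :
  (forall n, 0 <= a n) -> (forall n, a n.+1 <= a n) ->
  (forall n, 0 <= theta n) ->
  (\sum_(0 <= k < n)
      (expeR (- Psi Pi (a k) (theta k)) - (expR (- (theta k * t k)))%:E))%E
    @[n --> \oo] --> +oo%E ->
  (\sum_(n <oo) Psi Pi (a n.+1) (theta n) < +oo)%E ->
  {ae P, forall w M, exists2 n, (M <= n)%N & Y (a n) w <= t n}.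
Proof.
move=> a0 a_noninc theta0 div fin.
(* [Z n] is a deterministic measurable function [q n] of the increment [X_n], as the product formula
   requires. *)
pose q n x := Num.max 0 (expR (- (theta n * x)) - expR (- (theta n * t n))).
pose Z n w := q n (Y (a n) w - Y (a n.+1) w).
have inc0 n w : 0 <= Y (a n) w - Y (a n.+1) w.
  by rewrite subr_ge0; exact: (pja_nondecreasing HY).
have q0 n x : 0 <= q n x by rewrite le_max lexx.
have Z01 n w : 0 <= Z n w <= 1.
  rewrite q0/= ge_max ler01/= lerBlDr (@le_trans _ _ 1)//.
    by rewrite -[leRHS]expR0 ler_expR oppr_le0 mulr_ge0.
  by rewrite lerDl expR_ge0.
have mq n : measurable_fun [set: R] (q n).
  apply: measurable_maxr => //; apply: measurable_funB => //.
  by apply/measurable_EFinP; exact: (@measurable_expRM _ _ _ id).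
have mZ n : measurable_fun [set: T] (Z n).
  by apply: measurableT_comp => //; exact: measurable_increment.
pose p n := fine (expeR (- Psi Pi (a n) (theta n))) - expR (- (theta n * t n)).
have pE n : ((p n)%:E = expeR (- Psi Pi (a n) (theta n)) -
    (expR (- (theta n * t n)))%:E)%E.
  by rewrite EFinB fineK// laplace_transform_fin_num.
have pdiv : \sum_(0 <= i < n) p i @[n --> \oo] --> +oo.
  apply/cvgeryP; under eq_fun do rewrite -sumEFin.
  by under eq_fun do under eq_bigr do rewrite pE.
(* Since [Y 0 <= Y (a n.+1)], replacing [X_n] by the larger [Y (a n) - Y 0] lowers the exponential,
   and the latter has a known Laplace transform. *)
have pZ n : ((p n)%:E <= \int[P]_w (Z n w)%:E)%E.
  rewrite pE leeBlDr// -laplace_transform_increment//.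
  apply: (@le_trans _ _
      (\int[P]_w ((Z n w)%:E + (expR (- (theta n * t n)))%:E))%E).
    apply: ge0_le_integral => //.
    - by apply: measurable_expRM; exact: measurable_increment.
    - by apply: emeasurable_funD => //; exact/measurable_EFinP.
    - move=> w _; rewrite -EFinD lee_fin -lerBlDr.
      apply: (@le_trans _ _ (expR (- (theta n * (Y (a n) w - Y (a n.+1) w))) -
        expR (- (theta n * t n)))).
        rewrite lerD2r ler_expR lerN2 ler_wpM2l// lerD2l lerN2.
        exact: (pja_nondecreasing HY).
      by rewrite le_max lexx orbT.
  rewrite ge0_integralD//.
  - by rewrite integral_cst//= probability_setT mule1.
  - by move=> w _; rewrite lee_fin; exact: q0.
  - exact/measurable_EFinP.
have indZ n : (\int[P]_w (\prod_(i < n) expR (- Z i w))%:E =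
    \prod_(i < n) \int[P]_w (expR (- Z i w))%:E)%E.
  (* Independence of increments is stated for increasing times. *)
  pose s i := a (n - i)%N.
  (* Past [n], truncated subtraction keeps [s] constant at [a 0]. *)
  have s_mono i : s i <= s i.+1.
    rewrite /s subnS; case: (n - i)%N => //=.
  have indX := @pja_independent_increments _ _ _ _ _ _ HY n s (a0 _) s_mono.
  (* [rev_ord i] is [n - i.+1], so the increment from [s i] to [s i.+1] is [X_(n-i-1)]. *)
  have XE (i : 'I_n) w : Z (rev_ord i) w = q (rev_ord i) (Y (s i.+1) w - Y (s i) w).
    by rewrite /Z /s /= subnSK.
  under eq_integral do rewrite (reindex_inj rev_ord_inj)/=.
  rewrite [RHS](reindex_inj rev_ord_inj)/=.
  under eq_integral do under eq_bigr do rewrite XE.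
  under [RHS]eq_bigr do under eq_integral do rewrite XE.
  apply: (mutually_independent_integral_prod
    (h := fun i x => expR (- q (rev_ord i) x)) _ indX).
  - by move=> i; apply: measurable_increment; exact: a0.
  - move=> i; apply: (measurableT_comp (@measurable_expR R)).
    exact: measurableT_comp.
  - by move=> i x; rewrite expR_ge0/= -[leRHS]expR0 ler_expR oppr_le0 q0.
have Zdiv := ae_nneseries_pinfty mZ Z01 indZ pZ pdiv.
have := ae_summable_laplace (fun n => a0 n.+1) theta0 fin.
apply: filterS2 Zdiv => w Zw [Y0 Dw] M.
apply: contrapT => /forall2NP nle.
(* If [t_n < Y (a n)], replacing [t_n] by [Y (a n)] in the subtracted term bounds the difference by
   [exp (- theta_n X_n) * D_n], hence by [D_n]. *)
have Zle n : (M <= n)%N ->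
    Z n w <= 1 - expR (- (theta n * (Y (a n.+1) w - Y 0 w))).
  move=> Mn; have [//|/negP] := nle n; rewrite -ltNge => tY.
  have D0 : 0 <= Y (a n.+1) w - Y 0 w.
    by rewrite subr_ge0; exact: (pja_nondecreasing HY).
  have E1 : expR (- (theta n * (Y (a n.+1) w - Y 0 w))) <= 1.
    by rewrite -[leRHS]expR0 ler_expR oppr_le0 mulr_ge0.
  have F1 : expR (- (theta n * (Y (a n) w - Y (a n.+1) w))) <= 1.
    by rewrite -[leRHS]expR0 ler_expR oppr_le0 mulr_ge0.
  rewrite ge_max subr_ge0 E1/=.
  apply: (@le_trans _ _ (expR (- (theta n * (Y (a n) w - Y (a n.+1) w))) -
      expR (- (theta n * Y (a n) w)))).
    by rewrite lerD2l lerN2 ler_expR lerN2 ler_wpM2l// ltW.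
  have -> : - (theta n * Y (a n) w) =
      - (theta n * (Y (a n) w - Y (a n.+1) w)) +
      - (theta n * (Y (a n.+1) w - Y 0 w)) by rewrite Y0; ring.
  rewrite expRD -[X in X - _]mulr1 -mulrBr.
  by rewrite ler_piMl// subr_ge0.
have DE0 n : 0 <= 1 - expR (- (theta n * (Y (a n.+1) w - Y 0 w))).
  rewrite subr_ge0 -[leRHS]expR0 ler_expR oppr_le0 mulr_ge0// subr_ge0.
  exact: (pja_nondecreasing HY).
have Z0 n : (0 <= (Z n w)%:E)%E by rewrite lee_fin q0.
suff : (\sum_(n <oo) (Z n w)%:E < +oo)%E by rewrite Zw.
rewrite (nneseries_split 0 M)// sumEFin add0n lte_add_pinfty ?ltry//.
apply: le_lt_trans Dw.
rewrite -nneseries_addn// [leRHS](nneseries_split 0 M)//; last first.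
  by move=> n _; rewrite lee_fin DE0.
rewrite add0n -[X in (_ + X)%E]nneseries_addn//.
apply: lee_paddl; first by apply: sume_ge0 => n _; rewrite lee_fin DE0.
by apply: lee_nneseries => // n _; rewrite lee_fin Zle// leq_addl.
Qed.

End additive_process.

(** * Shifted divergent series and assembly of both bounds *)

(** Finiteness of the terms excludes a divergence carried by the first [N] of them. *)
Lemma cvg_sum_addn_pinfty (R : realType) (u : (\bar R)^nat) (N : nat) :
  (forall n, u n \is a fin_num) ->
  (\sum_(0 <= k < n) u k)%E @[n --> \oo] --> +oo%E ->
  (\sum_(0 <= k < n) u (k + N)%N)%E @[n --> \oo] --> +oo%E.
Proof.
move=> ufin /cvgeyPge u_lim; apply/cvgeyPge => A.
have cfin : (\sum_(0 <= k < N) u k)%E \is a fin_num.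
  by apply/sum_fin_numP => k _ _.
have [M _ AM] := u_lim (A + fine (\sum_(0 <= k < N) u k)%E).
exists M => // n /= Mn.
have := AM (n + N)%N (leq_trans Mn (leq_addr _ _)).
rewrite /= EFinD fineK// [leRHS](big_cat_nat (n := N))//= ?leq_addl// addeC.
rewrite leeD2lE//.
by rewrite -[X in index_iota X _]add0n big_addn addnK.
Qed.

Theorem theorem3p1 (d : measure_display) (T : measurableType d) (R : realType)
    (P : probability T R) (Y : R -> T -> R)
    (Pi : {measure set (R * R) -> \bar R})
    (HY : pure_jump_additive P Y Pi)
    (f phi : R -> R) (theta t : nat -> R)
    (f_pos : forall x : R, 0 < x < 1 -> 0 < f x)
    (f_incr : forall x y : R, 0 < x -> x <= y -> y < 1 -> f x <= f y)
    (f_lim : f x @[x --> 0^'+] --> 0)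
    (phi_pos : forall u : R, 0 < u -> 0 < phi u)
    (phi_decr : forall u v : R, 0 < u -> u <= v -> phi v <= phi u)
    (phi_lim : phi u @[u --> +oo] --> 0)
    (theta_pos : forall n, 0 < theta n)
    (theta_lim : theta n @[n --> \oo] --> +oo)
    (t_def : forall n, t n = phi (theta n))
    (t_in01 : forall n, 0 < t n < 1) :
  ((\sum_(0 <= n <oo)
       expeR ((theta n * t n)%:E - Psi Pi (f (t n)) (theta n)) < +oo)%E ->
   {ae P, forall w,
     (limf_esup (fun s : R => process_inverse Y s w / (f s)%:E) 0%R^'+ <=
      limn_esup (fun n => (f (t n) / f (t n.+1))%:E))%E})
  /\
  (phi u * u @[u --> +oo] --> +oo ->
   (\sum_(0 <= k < n)
       (expeR (- Psi Pi (f (t k)) (theta k)) - (expR (- (theta k * t k)))%:E))%E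
     @[n --> \oo] --> +oo%E ->
   (\sum_(0 <= n <oo) Psi Pi (f (t n.+1)) (theta n) < +oo)%E ->
   {ae P, forall w,
     (1 <= limf_esup (fun s : R => process_inverse Y s w / (f s)%:E) 0%R^'+)%E}).
Proof.
have t_lim : t n @[n --> \oo] --> 0.
  by under eq_fun do rewrite t_def; exact: (cvg_comp _ _ theta_lim phi_lim).
have ft0 n : 0 <= f (t n) by apply: ltW; exact: f_pos.
have theta0 n : 0 <= theta n by exact: ltW.
have Y_mono w x y : 0 <= x -> x <= y -> Y x w <= Y y w.
  exact: (pja_nondecreasing HY).
split=> [fin|phiu_lim div fin].
  apply: (filterS _ (ae_gt_near HY ft0 theta_pos fin)) => w.
  exact: limsup_inverse_le.
suff io : {ae P, forall w M, exists2 n, (M <= n)%N & Y (f (t n)) w <= t n}.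
  apply: (filterS _ io) => w wM.
  exact: (limsup_inverse_ge1 f_pos t_in01 t_lim (Y_mono w) wM).
have [[N theta_incr]|] :=
    pselect (exists N, forall n, (N <= n)%N -> theta n < theta n.+1).
  (* From [N] on [theta] increases, so [t = phi theta] and then [f t] are nonincreasing; all
     sequences are shifted by [N]. *)
  have io : {ae P, forall w M, exists2 n, (M <= n)%N &
      Y (f (t (n + N)%N)) w <= t (n + N)%N}.
    apply: (ae_le_infinitely_often HY (a := fun n => f (t (n + N)%N))
      (theta := fun n => theta (n + N)%N)) => //.
    - move=> n; apply: f_incr.
      + by have /andP[] := t_in01 (n.+1 + N)%N.
      + by rewrite !t_def phi_decr//= ltW// theta_incr// leq_addl.
      + by have /andP[] := t_in01 (n + N)%N.
    - apply: cvg_sum_addn_pinfty div => n.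
      by rewrite fin_numB laplace_transform_fin_num.
    - apply: le_lt_trans fin.
      rewrite (nneseries_addn (f := fun n => Psi Pi (f (t n.+1)) (theta n))).
        rewrite [leRHS](nneseries_split 0 N); last by move=> *; apply: Psi_ge0.
        by rewrite add0n leeDr// sume_ge0// => *; apply: Psi_ge0.
      by move=> n; apply: Psi_ge0.
  apply: (filterS _ io) => w wM M; have [n Mn Yn] := wM M.
  by exists (n + N)%N => //; exact: leq_trans (leq_addr _ _).
move=> /forallNP nonincr.
apply: (filterS _ (ae_summable_laplace HY (fun n => ft0 n.+1) theta0 fin)).
move=> w [Y0 Dw] M.
(* The threshold 1/2 matches [theta_n * Y_(a_(n+1)) >= 1]: then [exp (theta_n * Y_(a_(n+1))) >= 2],
   that is [D_n >= 1/2]. *)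
have [N1 _ DN1] : \forall n \near \oo,
    ((1 - expR (- (theta n * (Y (f (t n.+1)) w - Y 0 w))))%:E < (2^-1)%:E)%E.
  apply: nneseries_near_lt => // n.
  rewrite lee_fin subr_ge0 -[leRHS]expR0 ler_expR oppr_le0 mulr_ge0//.
  by rewrite subr_ge0 Y_mono.
have [N2 _ thetatN2] : \forall n \near \oo, 1 <= theta n * t n.
  have h : phi (theta n) * theta n @[n --> \oo] --> +oo.
    exact: (cvg_comp _ _ theta_lim phiu_lim).
  move/cvgryPge : h => /(_ 1); apply: filterS => n.
  by rewrite t_def mulrC.
have /existsNP[n /not_implyP[Nn /negP]] := nonincr (maxn M (maxn N1 N2)).
rewrite -leNgt => theta_n.
move: Nn; rewrite !geq_max => /and3P[Mn N1n N2n].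
exists n => //.
have tn : t n <= t n.+1 by rewrite !t_def phi_decr.
have ftn : f (t n) <= f (t n.+1).
  apply: f_incr => //; first by have /andP[] := t_in01 n.
  by have /andP[] := t_in01 n.+1.
(* Otherwise [theta_n * Y_(a_(n+1)) >= theta_n * Y_(a_n) >= theta_n * t_n >= 1], against
   [D_n < 1/2]. *)
rewrite leNgt; apply/negP => tY.
have := DN1 n N1n; rewrite /= lte_fin Y0 subr0; apply/negP; rewrite -leNgt.
have Y1 : 1 <= theta n * Y (f (t n.+1)) w.
  apply: le_trans (thetatN2 n N2n) _; rewrite ler_wpM2l//.
  by apply: le_trans (ltW tY) _; exact: Y_mono.
have : 2 <= expR (theta n * Y (f (t n.+1)) w).
  by apply: le_trans (expR_ge1Dx _); lra.
rewrite expRN => e2.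
have : (expR (theta n * Y (f (t n.+1)) w))^-1 <= 2^-1.
  by rewrite lef_pV2 ?posrE ?expR_gt0.
lra.
Qed.
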